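(* Let $B^-_{r,s}\,\underline{\otimes}\,B^+_{r,s}$ be the braided tensor product algebra. There is an algebra isomorphism $$B^-_{r,s}\,\underline{\otimes}\,B^+_{r,s}\;\cong\;W_{r,s}(\mathfrak g),\qquad f\otimes e\longmapsto fe,$$ where $f\in B^-_{r,s}$, $e\in B^+_{r,s}$.
   Context: Everything is over $\mathbb C$. Let $\mathfrak g$ be a finite-dimensional complex semisimple Lie algebra with Cartan matrix $(a_{ij})_{i,j\in I}$, $I=\{1,\dots,n\}$, and relatively prime positive integers $d_i$ with $d_ia_{ij}=d_ja_{ji}$. Let $\alpha_i$ be the simple roots, $Q=\bigoplus\mathbb Z\alpha_i$. Let $r,s\in\mathbb C^*$ with $rs^{-1}$ not a root of unity; $r_i=r^{d_i}$, $s_i=s^{d_i}$. The Euler form is the bilinear form on $Q$ with $\langle i,j\rangle:=\langle\alpha_i,\alpha_j\rangle=d_ia_{ij}$ if $i<j$, $d_i$ if $i=j$, $0$ if $i>j$. Notation: $(k)_v=1+v+\dots+v^{k-1}$, $(k)_v^!=(1)_v\cdots(k)_v$, $(0)_v^!=1$, $\binom{k}{l}_v=\frac{(k)^!_v}{(l)^!_v(k-l)^!_v}$; $c_{ij}^{k}=(r_is_i^{-1})^{k(k-1)/2}r^{k\langle j,i\rangle}s^{-k\langle i,j\rangle}$ for $i\ne j$. $U^{\ge}_{r,s}$ is the Hopf algebra generated by $e_i,\omega_i'^{\pm1}$ ($i\in I$) with relations: the $\omega_i'^{\pm1}$ commute, $\omega_i'\omega_i'^{-1}=1$, $\omega_i'e_j\omega_i'^{-1}=r^{-\langle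 i,j\rangle}s^{\langle j,i\rangle}e_j$, $\sum_{k=0}^{1-a_{ij}}(-1)^k\binom{1-a_{ij}}{k}_{r_is_i^{-1}}c^k_{ij}e_i^{1-a_{ij}-k}e_je_i^k=0$ ($i\ne j$); $\omega'_i$ is grouplike, $\Delta(e_i)=e_i\otimes\omega_i'+1\otimes e_i$, $\varepsilon(e_i)=0$, $S(e_i)=-e_i\omega_i'^{-1}$. $U^{\le}_{r,s}$ is the Hopf algebra generated by $f_i,\omega_i^{\pm1}$ with relations: the $\omega_i^{\pm1}$ commute, $\omega_i\omega_i^{-1}=1$, $\omega_if_j\omega_i^{-1}=r^{-\langle j,i\rangle}s^{\langle i,j\rangle}f_j$, $\sum_{k=0}^{1-a_{ij}}(-1)^k\binom{1-a_{ij}}{k}_{r_is_i^{-1}}c^k_{ij}f_i^{k}f_jf_i^{1-a_{ij}-k}=0$ ($i\ne j$); $\omega_i$ is grouplike, $\Delta(f_i)=f_i\otimes1+\omega_i\otimes f_i$, $\varepsilon(f_i)=0$, $S(f_i)=-\omega_i^{-1}f_i$. $\varphi:U^{\ge}_{r,s}\times U^{\le}_{r,s}\to\mathbb C$ is the skew Hopf pairing, i.e. bilinear with $\varphi(a,bb')=\sum\varphi(a_{(1)},b)\varphi(a_{(2)},b')$, $\varphi(aa',b)=\sum\varphi(a',b_{(1)})\varphi(a,b_{(2)})$, $\varphi(a,1)=\varepsilon(a)$, $\varphi(1,b)=\varepsilon(b)$, determined by $\varphi(e_i,f_j)=\frac{\delta_{ij}}{s_i-r_i}$, $\varphi(\omega_i',\omega_j)=r^{\langle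 i,j\rangle}s^{-\langle j,i\rangle}$, $\varphi(e_i,\omega_j)=\varphi(\omega_i',f_j)=0$. The Heisenberg double $H_\varphi(U^{\ge}_{r,s},U^{\le}_{r,s})$ is $U^{\le}_{r,s}\otimes U^{\ge}_{r,s}$ (elements $b\sharp a$) with product $(b\sharp a)(b'\sharp a')=\sum\varphi(a_{(1)},b'_{(1)})\,bb'_{(2)}\sharp a_{(2)}a'$; $U^{\ge}_{r,s}$ and $U^{\le}_{r,s}$ are subalgebras via $a\mapsto1\sharp a$, $b\mapsto b\sharp1$. Put $e_i'=(s_i-r_i)\omega_i'^{-1}e_i$, so $\Delta(e_i')=e_i'\otimes1+\omega_i'^{-1}\otimes e_i'$ and $\varphi(e_i',f_j)=\delta_{ij}$. $B^+_{r,s}$, $B^-_{r,s}$, $W_{r,s}(\mathfrak g)$ are the subalgebras generated respectively by the $e_i'$, by the $f_i$, and by all $e_i',f_i$ ($i\in I$). Braided tensor product: $\Delta$ restricts to a coaction $B^+_{r,s}\to U^{\ge}_{r,s}\otimes B^+_{r,s}$, written $e\mapsto\sum e_{(-1)}\otimes e_{(0)}$, and $U^{\ge}_{r,s}$ acts on $B^-_{r,s}$ by the Schrödinger representation $a\cdot y=\sum\varphi(a,y_{(1)})y_{(2)}$. The algebra $B^-_{r,s}\underline\otimes B^+_{r,s}$ is the vector space $B^-_{r,s}\otimes B^+_{r,s}$ with product $(f\otimes e)(g\otimes h)=\sum f\,(e_{(-1)}\cdot g)\otimes e_{(0)}h$. *)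

(* Defs.v *)
From HB Require Import structures.
From mathcomp Require Import all_boot all_order all_algebra.
From mathcomp Require Import ring_quotient generic_quotient.
From mathcomp Require Import mathcomp_extra boolp classical_sets reals complex.
From mathcomp Require Import ring.
From mathcomp Require Import finmap xfinmap monalg.
Set Implicit Arguments.
Unset Strict Implicit.
Unset Printing Implicit Defensive.
Import Order.TTheory GRing.Theory Num.Theory.
Local Open Scope ring_scope.
Local Open Scope quotient_scope.

(* MathComp Analysis for classical reasoning (quotients by arbitrary
   subspaces, Zorn) and for realType; the algebra itself is over any field. *)
Section LinearQuotient.
Context {K : fieldType} {V : lmodType K}.
Implicit Types (S : V -> Prop) (u v : V).

Inductive lspan S : V -> Prop :=
| span_base v : S v -> lspan S v
| span0 : lspan S 0
| spanD u v : lspan S u -> lspan S v -> lspan S (u + v)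
| spanZ a v : lspan S v -> lspan S (a *: v).

Definition spanb S : {pred V} := fun v => `[< lspan S v >].

Lemma spanbP S v : reflect (lspan S v) (v \in spanb S).
Proof. exact: asboolP. Qed.

Fact spanb_zmod S : zmod_closed (spanb S).
Proof.
split; first by apply/spanbP; exact: span0.
move=> u v /spanbP hu /spanbP hv; apply/spanbP.
by rewrite -scaleN1r; apply: spanD => //; apply: spanZ.
Qed.

HB.instance Definition _ S := GRing.isZmodClosed.Build V (spanb S) (spanb_zmod S).

Definition quotmod S : Type := Quotient.quot (spanb S).
HB.instance Definition _ S := GRing.Zmodule.on (quotmod S).
HB.instance Definition _ S : EqQuotient V (Quotient.equiv (spanb S)) (quotmod S) :=
  EqQuotient.on (quotmod S).

Definition cls S (v : V) : quotmod S := \pi_(Quotient.quot (spanb S)) v.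
Definition rpr S (x : quotmod S) : V := repr (x : Quotient.quot (spanb S)).

Lemma rprK S : cancel (@rpr S) (@cls S).
Proof. by move=> x; rewrite /cls /rpr reprK. Qed.

Lemma clsP S u v : cls S u = cls S v <-> lspan S (u - v).
Proof.
split => [/eqP|h]; last apply/eqP.
  by rewrite /cls -Quotient.idealrBE => /spanbP.
by rewrite /cls -Quotient.idealrBE; apply/spanbP.
Qed.

Lemma clsD S u v : cls S (u + v) = cls S u + cls S v.
Proof. by rewrite /cls raddfD. Qed.
Lemma clsB S u v : cls S (u - v) = cls S u - cls S v.
Proof. by rewrite /cls raddfB. Qed.
Lemma cls0 S : cls S 0 = 0.
Proof. by rewrite /cls raddf0. Qed.

Lemma cls_eq0 S v : cls S v = 0 <-> lspan S v.
Proof. by rewrite -(cls0 S) clsP subr0. Qed.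

Lemma rprP S v : lspan S (rpr (cls S v) - v).
Proof. by apply/clsP; rewrite rprK. Qed.

Definition qscale S a (x : quotmod S) : quotmod S := cls S (a *: rpr x).

Lemma qscaleE S a v : qscale a (cls S v) = cls S (a *: v).
Proof. by apply/clsP; rewrite -scalerBr; apply: spanZ; exact: rprP. Qed.

Fact qscaleA S a b (x : quotmod S) : qscale a (qscale b x) = qscale (a * b) x.
Proof. by rewrite -(rprK x) !qscaleE scalerA. Qed.
Fact qscale1 S : left_id 1 (@qscale S).
Proof. by move=> x; rewrite -(rprK x) qscaleE scale1r. Qed.
Fact qscaleDr S : right_distributive (@qscale S) +%R.
Proof.
by move=> a x y; rewrite -(rprK x) -(rprK y) -clsD !qscaleE scalerDr clsD.
Qed.
Fact qscaleDl S (x : quotmod S) : {morph (@qscale S)^~ x : a b / a + b}.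
Proof. by move=> a b; rewrite -(rprK x) !qscaleE scalerDl clsD. Qed.

HB.instance Definition _ S := GRing.Zmodule_isLmodule.Build K (quotmod S)
  (@qscaleA S) (@qscale1 S) (@qscaleDr S) (@qscaleDl S).

Fact cls_linear S : linear (cls S).
Proof. by move=> a u v; rewrite clsD -qscaleE. Qed.
HB.instance Definition _ S := GRing.isLinear.Build K V (quotmod S) _ (cls S) (cls_linear S).

End LinearQuotient.

Section AlgebraQuotient.
Context {K : fieldType} {A : algType K}.
Variable S : A -> Prop.

Definition ideal_base (z : A) : Prop := exists x y s, S s /\ z = x * s * y.

Definition ideal : A -> Prop := lspan ideal_base.

Lemma idealMl x z : ideal z -> ideal (x * z).
Proof.
elim=> [v [x' [y [s [hs ->]]]]||u v _ hu _ hv|a v _ hv].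
- by apply: span_base; exists (x * x'), y, s; rewrite !mulrA.
- by rewrite mulr0; exact: span0.
- by rewrite mulrDr; exact: spanD.
- by rewrite -scalerAr; exact: spanZ.
Qed.

Lemma idealMr x z : ideal z -> ideal (z * x).
Proof.
elim=> [v [x' [y [s [hs ->]]]]||u v _ hu _ hv|a v _ hv].
- by apply: span_base; exists x', (y * x), s; rewrite !mulrA.
- by rewrite mul0r; exact: span0.
- by rewrite mulrDl; exact: spanD.
- by rewrite -scalerAl; exact: spanZ.
Qed.

(* [proper] is only needed because algType excludes the zero ring. *)
Definition quotalg (proper : ~ ideal 1) : Type :=
  quotmod ideal_base.

Hypothesis proper : ~ ideal 1.
Local Notation Q := (quotalg proper).
HB.instance Definition _ := GRing.Lmodule.on Q.

Definition qcls : A -> Q := cls _.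
Definition qmul (x y : Q) : Q := qcls (rpr x * rpr y).

Lemma qmulE u v : qmul (qcls u) (qcls v) = qcls (u * v).
Proof.
apply/clsP.
set u' := rpr _; set v' := rpr _.
have -> : u' * v' - u * v = (u' - u) * v' + u * (v' - v).
  by rewrite mulrBl mulrBr addrA subrK.
by apply: spanD; [apply: idealMr | apply: idealMl]; exact: rprP.
Qed.

Lemma qclsK : cancel (@rpr _ _ _ : Q -> A) qcls.
Proof. exact: rprK. Qed.

Fact qmulA : associative qmul.
Proof. by move=> x y z; rewrite -(qclsK x) -(qclsK y) -(qclsK z) !qmulE mulrA. Qed.
Fact qmul1 : left_id (qcls 1) qmul.
Proof. by move=> x; rewrite -(qclsK x) qmulE mul1r. Qed.
Fact qmulr1 : right_id (qcls 1) qmul.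
Proof. by move=> x; rewrite -(qclsK x) qmulE mulr1. Qed.
Fact qmulDl : left_distributive qmul +%R.
Proof.
move=> x y z; rewrite -(qclsK x) -(qclsK y) -(qclsK z).
by rewrite -[qcls (rpr x) + _]clsD !qmulE mulrDl -[RHS]clsD.
Qed.
Fact qmulDr : right_distributive qmul +%R.
Proof.
move=> x y z; rewrite -(qclsK x) -(qclsK y) -(qclsK z).
by rewrite -[qcls (rpr y) + _]clsD !qmulE mulrDr -[RHS]clsD.
Qed.
Fact qone_neq0 : qcls 1 != 0.
Proof. by apply/eqP => /cls_eq0. Qed.

HB.instance Definition _ := GRing.Zmodule_isNzRing.Build Q
  qmulA qmul1 qmulr1 qmulDl qmulDr qone_neq0.

Lemma qclsM u v : qcls (u * v) = qcls u * qcls v.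
Proof. exact/esym/qmulE. Qed.
Lemma qclsZ a u : qcls (a *: u) = a *: qcls u.
Proof. exact/esym/qscaleE. Qed.

Fact qscaleAl (a : K) (x y : Q) : a *: (x * y) = (a *: x) * y.
Proof. by rewrite -(qclsK x) -(qclsK y) -[a *: qcls _]qclsZ -!qclsM -[LHS]qclsZ scalerAl. Qed.
Fact qscaleAr (a : K) (x y : Q) : a *: (x * y) = x * (a *: y).
Proof. by rewrite -(qclsK x) -(qclsK y) -[a *: qcls _]qclsZ -!qclsM -[LHS]qclsZ scalerAr. Qed.
HB.instance Definition _ := GRing.Lmodule_isLalgebra.Build K Q qscaleAl.
HB.instance Definition _ := GRing.Lalgebra_isAlgebra.Build K Q qscaleAr.
End AlgebraQuotient.

Definition lin (K : fieldType) (V W : lmodType K) (f : V -> W) : Prop :=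
  forall a u v, f (a *: u + v) = a *: f u + f v.

Definition bilin (K : fieldType) (V W X : lmodType K) (f : V -> W -> X) : Prop :=
  (forall w, lin (f^~ w)) /\ (forall v, lin (f v)).

Section LinTheory.
Context {K : fieldType} {V W X : lmodType K}.

Lemma lin0 (f : V -> W) : lin f -> f 0 = 0.
Proof.
move=> hf; have := hf 1 0 0; rewrite !scale1r addr0 => h.
by apply: (addIr (f 0)); rewrite add0r -h.
Qed.
Lemma linD (f : V -> W) : lin f -> {morph f : x y / x + y}.
Proof. by move=> hf x y; have := hf 1 x y; rewrite !scale1r. Qed.
Lemma linZ (f : V -> W) : lin f -> forall a, {morph f : x / a *: x}.
Proof. by move=> hf a x; have := hf a x 0; rewrite !addr0 lin0 // addr0. Qed.
Lemma linB (f : V -> W) : lin f -> {morph f : x y / x - y}.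
Proof. by move=> hf x y; rewrite -scaleN1r linD // linZ // scaleN1r. Qed.
Lemma lin_sumE (f : V -> W) I (r : seq I) (P : pred I) (F : I -> V) : lin f ->
  f (\sum_(i <- r | P i) F i) = \sum_(i <- r | P i) f (F i).
Proof. by move=> hf; apply: big_morph; [exact: linD | exact: lin0]. Qed.

Lemma lin_big I (r : seq I) (F : I -> V -> W) : (forall i, lin (F i)) ->
  lin (fun x => \sum_(i <- r) F i x).
Proof.
move=> hF a u v; rewrite scaler_sumr -big_split.
by apply: eq_bigr => i _; exact: hF.
Qed.
Lemma lin_id : lin (fun x : V => x).
Proof. by []. Qed.
Lemma lin_comp (g : W -> X) (f : V -> W) : lin g -> lin f -> lin (fun x => g (f x)).
Proof. by move=> hg hf a u v; rewrite hf hg. Qed.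
Lemma lin_scaler (f : V -> W) c : lin f -> lin (fun x => c *: f x).
Proof. by move=> hf a u v; rewrite hf scalerDr !scalerA mulrC. Qed.
Lemma lin_scalel (f : V -> K^o) w : lin f -> lin (fun x => (f x : K) *: w : W).
Proof. by move=> hf a u v; rewrite hf scalerDl -scalerA. Qed.
Lemma lin_linear (f : {linear V -> W}) : lin f.
Proof. by move=> a u v; rewrite linearP. Qed.
End LinTheory.

Section LinAlgTheory.
Context {K : fieldType} {V : lmodType K} {A : algType K}.
Lemma lin_mull (f : V -> A) c : lin f -> lin (fun x => f x * c).
Proof. by move=> hf a u v; rewrite hf mulrDl scalerAl. Qed.
Lemma lin_mulr (f : V -> A) c : lin f -> lin (fun x => c * f x).
Proof. by move=> hf a u v; rewrite hf mulrDr scalerAr. Qed.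
End LinAlgTheory.

Section Tensor.
Context {K : fieldType}.

Variant tensor_rel (V W : lmodType K) : {malg K[(V * W)%type]} -> Prop :=
| tensor_rell a v v' w :
    tensor_rel (<< (a *: v + v', w) >> - (a *: << (v, w) >> + << (v', w) >>))
| tensor_relr a v w w' :
    tensor_rel (<< (v, a *: w + w') >> - (a *: << (v, w) >> + << (v, w') >>)).

Definition tensor (V W : lmodType K) : Type := quotmod (@tensor_rel V W).
HB.instance Definition _ V W := GRing.Lmodule.on (tensor V W).

Section One.
Context {V W : lmodType K}.
Implicit Types (t : tensor V W).

Definition tens (v : V) (w : W) : tensor V W := cls _ << (v, w) >>.

(* A chosen decomposition of t as a finite sum of pure tensors (see trepK).
   A Sweedler-style sum over [trep t] does not depend on the choice as soon as
   the summand is bilinear (trep_sum); every such sum below is of this kind. *)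
Definition trep t : seq (V * W) :=
  [seq ((rpr t)@_p *: p.1, p.2) | p <- msupp (rpr t)].

Lemma tensP_l w : lin (tens^~ w).
Proof.
move=> a v v'; rewrite /tens -linearP; apply/clsP/span_base; exact: tensor_rell.
Qed.
Lemma tensP_r v : lin (tens v).
Proof.
move=> a w w'; rewrite /tens -linearP; apply/clsP/span_base; exact: tensor_relr.
Qed.

Lemma trepK t : \sum_(p <- trep t) tens p.1 p.2 = t.
Proof.
rewrite -[RHS]rprK [in RHS](monalgE (rpr t)) linear_sum /trep big_map /=.
apply: eq_bigr => p _; rewrite (linZ (tensP_l _)) /tens -linearZ /=.
congr cls; apply/malgP => k; rewrite mcoeffZ !mcoeffU -surjective_pairing.
by rewrite mulr_natr.
Qed.

Section Lift.
Context {X : lmodType K} {f : V -> W -> X}.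
Hypothesis hf : bilin f.

Let F (m : {malg K[(V * W)%type]}) := \sum_(p <- msupp m) m@_p *: f p.1 p.2.

Let FE (d : {fset (V * W)%type}) m : (msupp m `<=` d)%fset ->
  F m = \sum_(p <- d) m@_p *: f p.1 p.2.
Proof.
move=> le; rewrite /F (big_fset_incl _ le) //= => x xd /mcoeff_outdom ->.
by rewrite scale0r.
Qed.

Let F_lin : lin F.
Proof.
move=> a m m'; pose d := (msupp (a *: m + m') `|` (msupp m `|` msupp m'))%fset.
have [h1 [h2 h3]] : (msupp (a *: m + m') `<=` d)%fset /\
   (msupp m `<=` d)%fset /\ (msupp m' `<=` d)%fset.
  split; first by apply: fsubsetUl.
  by split; apply: fsubset_trans (fsubsetUr _ _);
    [apply: fsubsetUl | apply: fsubsetUr].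
rewrite (FE h1) (FE h2) (FE h3) scaler_sumr -big_split.
by apply: eq_bigr => p _; rewrite mcoeffD mcoeffZ scalerDl scalerA.
Qed.

Let FU v w : F << (v, w) >> = f v w.
Proof. by rewrite /F msuppU oner_eq0 big_seq_fset1 mcoeffUU scale1r. Qed.

Let F_span m : lspan (@tensor_rel V W) m -> F m = 0.
Proof.
elim=> [x []||u v _ hu _ hv|a v _ hv].
- move=> a v v' w; rewrite linB // F_lin !FU hf.1.
  by rewrite subrr.
- by move=> a v w w'; rewrite linB // F_lin !FU hf.2 subrr.
- exact: lin0.
- by rewrite linD // hu hv addr0.
- by rewrite linZ // hv scaler0.
Qed.

Definition tlift t : X := \sum_(p <- trep t) f p.1 p.2.

Lemma tlift_F t : tlift t = F (rpr t).
Proof.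
rewrite /tlift /trep big_map /F; apply: eq_bigr => p _ /=.
by rewrite (linZ (hf.1 _)).
Qed.

Let F_cls m : F (rpr (cls (@tensor_rel V W) m)) = F m.
Proof. by apply/eqP; rewrite -subr_eq0 -linB //; apply/eqP/F_span/rprP. Qed.

Lemma tlift_lin : lin tlift.
Proof.
move=> a s t; rewrite !tlift_F -F_lin -[RHS]F_cls.
by rewrite linearP /= !rprK.
Qed.

Lemma tliftE v w : tlift (tens v w) = f v w.
Proof. by rewrite tlift_F F_cls FU. Qed.
End Lift.

Lemma trep_sum (X : lmodType K) (f : V -> W -> X) (hf : bilin f) (l : seq (V * W)) :
  \sum_(p <- trep (\sum_(q <- l) tens q.1 q.2)) f p.1 p.2 =
  \sum_(p <- l) f p.1 p.2.
Proof.
have := lin_sumE l xpredT (fun q => tens q.1 q.2) (tlift_lin hf).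
by rewrite /tlift => ->; apply: eq_bigr => p _; exact: (tliftE hf).
Qed.

Lemma trep_tens (X : lmodType K) (f : V -> W -> X) (hf : bilin f) v w :
  \sum_(p <- trep (tens v w)) f p.1 p.2 = f v w.
Proof. exact: (tliftE hf). Qed.

Lemma bilin_tens : bilin tens.
Proof. by split; [exact: tensP_l | exact: tensP_r]. Qed.

Lemma tensor_ind (P : tensor V W -> Prop) :
  (forall v w, P (tens v w)) -> P 0 -> (forall s t, P s -> P t -> P (s + t)) ->
  forall t, P t.
Proof.
move=> h1 h2 h3 t; rewrite -(trepK t); elim: (trep t) => [|p l ih].
  by rewrite big_nil.
by rewrite big_cons; exact: h3.
Qed.
End One.

Lemma lin_trep (U V W X : lmodType K) (f : V -> W -> X) (g : U -> tensor V W) :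
  bilin f -> lin g -> lin (fun x => \sum_(p <- trep (g x)) f p.1 p.2).
Proof. by move=> hf hg; apply: (lin_comp (tlift_lin hf) hg). Qed.

Lemma lin_tensl (U V W : lmodType K) (g : U -> V) (w : W) : lin g ->
  lin (fun x => tens (g x) w).
Proof. by move=> hg; apply: (lin_comp (tensP_l _)). Qed.
Lemma lin_tensr (U V W : lmodType K) (g : U -> W) (v : V) : lin g ->
  lin (fun x => tens v (g x)).
Proof. by move=> hg; apply: (lin_comp (tensP_r _)). Qed.

Lemma tensor_eq (V W X : lmodType K) (f g : tensor V W -> X) :
  lin f -> lin g -> (forall v w, f (tens v w) = g (tens v w)) -> f =1 g.
Proof.
move=> hf hg h t; apply: (@tensor_ind V W (fun t => f t = g t)) => [||{}t s ht hs] //; first by rewrite !lin0.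
by rewrite !linD // hs ht.
Qed.

Definition tmap (V W V' W' : lmodType K) (f : V -> V') (g : W -> W')
    (t : tensor V W) : tensor V' W' := \sum_(p <- trep t) tens (f p.1) (g p.2).

Lemma tmap_lin (V W V' W' : lmodType K) (f : V -> V') (g : W -> W') :
  lin f -> lin g -> lin (tmap f g).
Proof.
move=> hf hg; apply: (lin_trep (f := fun x y => tens (f x) (g y))) => //.
by split => [w|v]; [apply: lin_tensl | apply: lin_tensr].
Qed.
Lemma tmapE (V W V' W' : lmodType K) (f : V -> V') (g : W -> W') v w :
  lin f -> lin g -> tmap f g (tens v w) = tens (f v) (g w).
Proof.
move=> hf hg; rewrite /tmap (trep_tens (f := fun x y => tens (f x) (g y))) //.
by split => [?|?]; [apply: lin_tensl | apply: lin_tensr].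
Qed.

(* A linear injection between vector spaces has a linear retraction. *)
Section Retraction.
Variables (U V : lmodType K) (i : U -> V).
Hypotheses (i_lin : lin i) (i_inj : injective i).

Let sub (Q : set V) := [/\ Q 0, (forall u v, Q u -> Q v -> Q (u + v)),
  (forall a v, Q v -> Q (a *: v)) & (forall u, Q (i u) -> u = 0)].

Let compl : exists2 Q, sub Q & forall v, exists u, Q (v - i u).
Proof.
pose T := {Q : set V | sub Q}.
pose R (P Q : T) := `[< sval P `<=` sval Q >]%classic.
have Rr (t : T) : R t t by apply/asboolP.
have Rt (r s t : T) : R r s -> R s t -> R r t.
  by move=> /asboolP h1 /asboolP h2; apply/asboolP; apply: (classical_sets.subset_trans h1 h2).
have Ra (s t : T) : R s t -> R t s -> s = t.
  move=> /asboolP h1 /asboolP h2.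
  by apply: eq_sig_hprop => [?|]; [exact: Prop_irrelevance | apply/seteqP].
have sub0 : sub [set 0]%classic.
  split=> //=; first by move=> ? ? -> ->; rewrite addr0.
    by move=> ? ? ->; rewrite scaler0.
  by move=> u; rewrite -(lin0 i_lin) => /i_inj.
have hchain (C : set T) : total_on C R -> exists t, forall s, C s -> R s t.
  move=> Ctot; have [[c0 Cc0]|C0] := pselect (exists c, C c); last first.
    by exists (exist _ _ sub0) => s Cs; case: C0; exists s.
  have hU : sub [set v | exists2 c, C c & sval c v]%classic.
    split=> /=.
    - by exists c0 => //; case: (svalP c0).
    - move=> u v [c Cc cu] [d Cd dv].
      case: (Ctot c d Cc Cd) => /asboolP h.
        by exists d => //; case: (svalP d) => _ hD _ _; apply: hD => //; exact: h.
      by exists c => //; case: (svalP c) => _ hD _ _; apply: hD => //; exact: h.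
    - by move=> a v [c Cc cv]; exists c => //; case: (svalP c) => _ _ hZ _; exact: hZ.
    - by move=> u [c Cc cu]; case: (svalP c) => _ _ _; exact.
  exists (exist _ _ hU) => s Cs; apply/asboolP => v sv /=.
  by exists s.
have [[Q hQ] Qmax] := Zorn Rr Rt Ra hchain.
exists Q => // v; have [//|nv] := pselect (exists u, Q (v - i u)).
case: (hQ) => Q0 QD QZ Qi.
pose Q' : set V := [set w | exists2 c, Q c & exists a, w = c + a *: v]%classic.
have hQ' : sub Q'.
  split=> /=.
  - by exists 0 => //; exists 0; rewrite scale0r addr0.
  - move=> _ _ [c hc [a ->]] [d hd [b ->]]; exists (c + d); first exact: QD.
    by exists (a + b); rewrite scalerDl addrACA.
  - move=> b _ [c hc [a ->]]; exists (b *: c); first exact: QZ.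
    by exists (b * a); rewrite scalerDr scalerA.
  - move=> u [c hc [a e]]; have [a0|a0] := eqVneq a 0.
      by move: e; rewrite a0 scale0r addr0 => e; apply: Qi; rewrite e.
    case: nv; exists (a^-1 *: u); rewrite (linZ i_lin) e scalerDr scalerA.
    rewrite mulVf // scale1r opprD addrCA subrr addr0 -scaleN1r scalerA.
    exact: QZ.
have : R (exist _ Q hQ) (exist _ Q' hQ').
  by apply/asboolP => w /= hw; exists w => //; exists 0; rewrite scale0r addr0.
move=> /Qmax [] e; exists 0; rewrite (lin0 i_lin) subr0.
by rewrite -e; exists 0 => //; exists 1; rewrite scale1r add0r.
Qed.

Lemma retraction : exists2 r : V -> U, lin r & cancel i r.
Proof.
have [Q [Q0 QD QZ Qi] hQ] := compl.
pose r v := projT1 (cid (hQ v)).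
have rP v : Q (v - i (r v)) by rewrite /r; case: cid.
have uniqr v u : Q (v - i u) -> r v = u.
  move=> h; apply/eqP; rewrite -subr_eq0; apply/eqP/Qi.
  rewrite (linB i_lin) -[_ - _](subrKA v) -[i (r v) - v]opprB.
  rewrite addrC; apply: QD => //.
  by rewrite -scaleN1r; apply: QZ.
exists r => [a u v|u]; last by apply: uniqr; rewrite subrr.
apply: uniqr; rewrite i_lin opprD addrACA -scalerBr.
by apply: QD => //; apply: QZ.
Qed.
End Retraction.

Lemma tmap_inj (V W V' W' : lmodType K) (f : V -> V') (g : W -> W') :
  lin f -> lin g -> injective f -> injective g -> injective (tmap f g).
Proof.
move=> hf hg fi gi.
have [f' hf' fK] := retraction hf fi; have [g' hg' gK] := retraction hg gi.
apply: (can_inj (g := tmap f' g')); apply: tensor_eq.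
- by apply: lin_comp; apply: tmap_lin.
- exact: lin_id.
- by move=> v w; rewrite !tmapE // fK gK.
Qed.

End Tensor.

Section Subalgebra.
Context {K : fieldType} {A : algType K}.
Implicit Type S : A -> Prop.

Inductive generated S : A -> Prop :=
| generated_base x : S x -> generated S x
| generated1 : generated S 1
| generatedD x y : generated S x -> generated S y -> generated S (x + y)
| generatedZ a x : generated S x -> generated S (a *: x)
| generatedM x y : generated S x -> generated S y -> generated S (x * y).

Definition generatedb S : {pred A} := fun x => `[< generated S x >].

Lemma generatedP S x : reflect (generated S x) (x \in generatedb S).
Proof. exact: asboolP. Qed.

Fact generatedb_add S : GRing.nmod_closed (generatedb S).
Proof.
split=> [|x y /generatedP hx /generatedP hy]; apply/generatedP.
  by rewrite -(scale0r 1); apply/generatedZ/generated1.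
exact: generatedD.
Qed.
Fact generatedb_mul2 S : GRing.mulr_2closed (generatedb S).
Proof.
by move=> x y /generatedP hx /generatedP hy; apply/generatedP/generatedM.
Qed.
Fact generatedb_mul1 S : 1 \in generatedb S.
Proof. exact/generatedP/generated1. Qed.
Fact generatedb_scale S : GRing.scaler_closed (generatedb S).
Proof. by move=> a x /generatedP hx; apply/generatedP/generatedZ. Qed.

HB.instance Definition _ S := GRing.isAddClosed.Build A (generatedb S) (generatedb_add S).
HB.instance Definition _ S := GRing.isMul2Closed.Build A (generatedb S) (@generatedb_mul2 S).
HB.instance Definition _ S := GRing.isMul1Closed.Build A (generatedb S) (generatedb_mul1 S).
HB.instance Definition _ S := GRing.isScaleClosed.Build K A (generatedb S) (@generatedb_scale S).

Fact generatedb_opp S : GRing.oppr_closed (generatedb S).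
Proof. by move=> x hx; rewrite -scaleN1r; apply: generatedb_scale. Qed.
HB.instance Definition _ S := GRing.isOppClosed.Build A (generatedb S) (@generatedb_opp S).

Record subalg S := Subalg { subalg_val : A; _ : subalg_val \in generatedb S }.
HB.instance Definition _ S := [isSub for @subalg_val S].
HB.instance Definition _ S := [Choice of subalg S by <:].
HB.instance Definition _ S := [SubChoice_isSubAlgebra of subalg S by <:].

Lemma subalg_gen S (x : subalg S) : generated S (val x).
Proof. exact/generatedP/(valP x). Qed.

Lemma lin_val S : lin (val : subalg S -> A).
Proof. by move=> a x y; rewrite linearP. Qed.
End Subalgebra.

Section Hopf.
Context {K : fieldType}.

(* The usual product of the algebra A (x) B. *)
Definition tmul (A B : algType K) (s t : tensor A B) : tensor A B :=
  \sum_(p <- trep s) \sum_(q <- trep t) tens (p.1 * q.1) (p.2 * q.2).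

Record hopfAlgebra (A : algType K) := HopfAlgebra {
  comul : {linear A -> tensor A A};
  counit : {linear A -> K^o};
  antipode : {linear A -> A};
  comulM : forall x y, comul (x * y) = tmul (comul x) (comul y);
  comul1 : comul 1 = tens 1 1;
  counitM : forall x y, counit (x * y) = (counit x : K) * counit y;
  counit1 : counit 1 = 1;
  coassoc : forall x,
    \sum_(p <- trep (comul x)) \sum_(q <- trep (comul p.1))
      tens q.1 (tens q.2 p.2) =
    \sum_(p <- trep (comul x)) \sum_(q <- trep (comul p.2))
      tens p.1 (tens q.1 q.2);
  counitl : forall x, \sum_(p <- trep (comul x)) (counit p.1 : K) *: p.2 = x;
  counitr : forall x, \sum_(p <- trep (comul x)) (counit p.2 : K) *: p.1 = x;
  antipodel : forall x,
    \sum_(p <- trep (comul x)) antipode p.1 * p.2 = (counit x : K) *: 1;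
  antipoder : forall x,
    \sum_(p <- trep (comul x)) p.1 * antipode p.2 = (counit x : K) *: 1
}.

Record skewPairing (A B : algType K) (HA : hopfAlgebra A) (HB : hopfAlgebra B) :=
  SkewPairing {
  pairing :> A -> B -> K^o;
  pairing_bilin : bilin pairing;
  pairing_mulr : forall a b b',
    pairing a (b * b') =
    \sum_(p <- trep (comul HA a)) (pairing p.1 b : K) * pairing p.2 b';
  pairing_mull : forall a a' b,
    pairing (a * a') b =
    \sum_(p <- trep (comul HB b)) (pairing a' p.1 : K) * pairing a p.2;
  pairing1r : forall a, pairing a 1 = counit HA a;
  pairing1l : forall b, pairing 1 b = counit HB b
}.

Lemma lin_tmull (A B : algType K) t : lin (fun s => @tmul A B s t).
Proof.
apply: (lin_trep (f := fun x y =>  \sum_(q <- trep t) tens (x * q.1) (y * q.2))).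
  by split => [?|?]; apply: lin_big => ?;
    [apply: lin_tensl | apply: lin_tensr]; apply: lin_mull; exact: lin_id.
exact: lin_id.
Qed.
Lemma lin_tmulr (A B : algType K) s : lin (@tmul A B s).
Proof.
apply: lin_big => p.
apply: (lin_trep (f := fun x y => tens (p.1 * x) (p.2 * y))).
  by split => [?|?]; [apply: lin_tensl | apply: lin_tensr]; apply: lin_mulr; exact: lin_id.
exact: lin_id.
Qed.
Lemma tmulE (A B : algType K) (a a' : A) (b b' : B) :
  tmul (tens a b) (tens a' b') = tens (a * a') (b * b').
Proof.
rewrite /tmul (trep_tens (f := fun x y =>
   \sum_(q <- trep (tens a' b')) tens (x * q.1) (y * q.2))); last first.
  by split => [?|?]; apply: lin_big => ?;
    [apply: lin_tensl | apply: lin_tensr]; apply: lin_mull; exact: lin_id.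
rewrite (trep_tens (f := fun x y => tens (a * x) (b * y))) //.
by split => [?|?]; [apply: lin_tensl | apply: lin_tensr]; apply: lin_mulr; exact: lin_id.
Qed.

Section Sweedler.
Variables (A : algType K) (H : hopfAlgebra A) (X : lmodType K).
Local Notation sw a := (trep (comul H a)).

Lemma lin_sw (V : lmodType K) (f : A -> A -> X) (g : V -> A) : bilin f -> lin g ->
  lin (fun x => \sum_(p <- sw (g x)) f p.1 p.2).
Proof.
by move=> hf hg; apply: lin_trep => //; apply: lin_comp => //; exact: lin_linear.
Qed.

Lemma swM (f : A -> A -> X) x y : bilin f ->
  \sum_(p <- sw (x * y)) f p.1 p.2 =
  \sum_(p <- sw x) \sum_(q <- sw y) f (p.1 * q.1) (p.2 * q.2).
Proof.
move=> hf; rewrite comulM /tmul.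
have hl := tlift_lin hf; rewrite -[LHS]/(tlift (f := f) _).
rewrite (lin_sumE _ _ _ hl); apply: eq_bigr => p _.
rewrite (lin_sumE _ _ _ hl); apply: eq_bigr => q _.
exact: (tliftE hf).
Qed.

Lemma sw1 (f : A -> A -> X) : bilin f -> \sum_(p <- sw 1) f p.1 p.2 = f 1 1.
Proof. by move=> hf; rewrite comul1 trep_tens. Qed.

Lemma swA (f : A -> A -> A -> X) x :
  (forall y z, lin (fun x => f x y z)) -> (forall x z, lin (fun y => f x y z)) ->
  (forall x y, lin (f x y)) ->
  \sum_(p <- sw x) \sum_(q <- sw p.1) f q.1 q.2 p.2 =
  \sum_(p <- sw x) \sum_(q <- sw p.2) f p.1 q.1 q.2.
Proof.
move=> h1 h2 h3.
have hf a : bilin (f a) by split.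
pose g (a : A) (t : tensor A A) := tlift (f := f a) t.
have hg : bilin g.
  split=> [t|a]; last exact: tlift_lin.
  by rewrite /g /tlift; apply: lin_big => p; apply: h1.
have gl := tlift_lin hg.
have gE a b c : tlift (f := g) (tens a (tens b c)) = f a b c.
  by rewrite (tliftE hg) /g (tliftE (hf a)).
move: (tlift (f := g)) gl gE => G gl gE {hg}.
have e l (F : A * A -> seq (A * A)) (t : A * A -> A * A -> tensor A (tensor A A)) :
    G (\sum_(p <- l) \sum_(q <- F p) t p q) =
    \sum_(p <- l) \sum_(q <- F p) G (t p q).
  by rewrite (lin_sumE _ _ _ gl); apply: eq_bigr => p _; rewrite (lin_sumE _ _ _ gl).
have h := etrans (esym (e _ (fun p => sw p.1) (fun p q => tens q.1 (tens q.2 p.2))))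
  (etrans (congr1 G (coassoc H x))
    (e _ (fun p => sw p.2) (fun p q => tens p.1 (tens q.1 q.2)))).
transitivity (\sum_(p <- sw x) \sum_(q <- sw p.1) G (tens q.1 (tens q.2 p.2))).
  by apply: eq_bigr => p _; apply: eq_bigr => q _; rewrite gE.
by rewrite h; apply: eq_bigr => p _; apply: eq_bigr => q _; rewrite gE.
Qed.
End Sweedler.
End Hopf.
Arguments lin_sw {K A} H {X V f g}.
Arguments swM {K A} H {X} f x y.
Arguments sw1 {K A} H {X} f.
Arguments swA {K A} H {X} f x.

Section Heisenberg.
Context {K : fieldType} {A B : algType K}.
Variables (HA : hopfAlgebra A) (HB : hopfAlgebra B) (phi : skewPairing HA HB).
Local Notation swa a := (trep (comul HA a)).
Local Notation swb b := (trep (comul HB b)).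

Definition heisenberg_mul (s t : tensor B A) : tensor B A :=
  \sum_(x <- trep s) \sum_(y <- trep t)
    \sum_(a <- swa x.2) \sum_(b <- swb y.1)
      (phi a.1 b.1 : K) *: tens (x.1 * b.2) (a.2 * y.2).

Lemma lin_phil (V : lmodType K) (f : V -> A) b : lin f -> lin (fun x => phi (f x) b).
Proof. by move=> hf; exact: (lin_comp ((pairing_bilin phi).1 b) hf). Qed.
Lemma lin_phir (V : lmodType K) (f : V -> B) a : lin f -> lin (fun x => phi a (f x)).
Proof. by move=> hf; exact: (lin_comp ((pairing_bilin phi).2 a) hf). Qed.

Let core (b : B) (a : A) (b' : B) (a' : A) : tensor B A :=
  \sum_(x <- swa a) \sum_(y <- swb b')
     (phi x.1 y.1 : K) *: tens (b * y.2) (x.2 * a').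

Let core1 a b' a' : lin (fun b => core b a b' a').
Proof.
apply: lin_big => x; apply: lin_big => y; apply: lin_scaler; apply: lin_tensl.
by apply: lin_mull; exact: lin_id.
Qed.
Let core2 b b' a' : lin (fun a => core b a b' a').
Proof.
apply: (lin_sw _ (f := fun a1 a2 =>
  \sum_(y <- swb b') (phi a1 y.1 : K) *: tens (b * y.2) (a2 * a')));
  last exact: lin_id.
split=> a''; apply: lin_big => y.
  by apply: lin_scalel; apply: lin_phil; exact: lin_id.
by apply: lin_scaler; apply: lin_tensr; apply: lin_mull; exact: lin_id.
Qed.
Let core3 b a a' : lin (fun b' => core b a b' a').
Proof.
apply: lin_big => x; apply: (lin_sw _ (f := fun b1 b2 =>
  (phi x.1 b1 : K) *: tens (b * b2) (x.2 * a'))); last exact: lin_id.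
split=> b''.
  by apply: lin_scalel; apply: lin_phir; exact: lin_id.
by apply: lin_scaler; apply: lin_tensl; apply: lin_mulr; exact: lin_id.
Qed.
Let core4 b a b' : lin (fun a' => core b a b' a').
Proof.
apply: lin_big => x; apply: lin_big => y; apply: lin_scaler; apply: lin_tensr.
by apply: lin_mulr; exact: lin_id.
Qed.

Lemma heisenberg_mulE b a b' a' :
  heisenberg_mul (tens b a) (tens b' a') =
  \sum_(x <- swa a) \sum_(y <- swb b')
     (phi x.1 y.1 : K) *: tens (b * y.2) (x.2 * a').
Proof.
rewrite /heisenberg_mul (trep_tens (f := fun u v =>
  \sum_(y <- trep (tens b' a')) core u v y.1 y.2)); last first.
  by split=> ?; apply: lin_big => ?.
by rewrite (trep_tens (f := core b a)).
Qed.

Lemma lin_heisenbergl t : lin (heisenberg_mul^~ t).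
Proof.
apply: (lin_trep (f := fun u v => \sum_(y <- trep t) core u v y.1 y.2));
  last exact: lin_id.
by split=> ?; apply: lin_big => ?.
Qed.
Lemma lin_heisenbergr s : lin (heisenberg_mul s).
Proof.
by apply: lin_big => x; apply: (lin_trep (f := core x.1 x.2)); [|exact: lin_id].
Qed.

Local Notation hmul := heisenberg_mul.

Fact heisenberg_mul1l : left_id (tens 1 1) hmul.
Proof.
apply: tensor_eq; [exact: lin_heisenbergr|exact: lin_id|] => b' a'.
rewrite heisenberg_mulE (sw1 _ (fun a1 a2 => \sum_(y <- swb b')
   (phi a1 y.1 : K) *: tens (1 * y.2) (a2 * a'))); last first.
  split=> a''; apply: lin_big => y.
    by apply: lin_scalel; apply: lin_phil; exact: lin_id.
  by apply: lin_scaler; apply: lin_tensr; apply: lin_mull; exact: lin_id.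
rewrite -[in RHS](counitl HB b').
rewrite (lin_sumE _ _ _ (lin_tensl a' (@lin_id _ _))).
by apply: eq_bigr => y _; rewrite !mul1r pairing1l (linZ (lin_tensl a' (@lin_id _ _))).
Qed.

Fact heisenberg_mul1r : right_id (tens 1 1) hmul.
Proof.
apply: tensor_eq; [exact: lin_heisenbergl|exact: lin_id|] => b a.
rewrite heisenberg_mulE -[in RHS](counitl HA a).
rewrite (lin_sumE _ _ _ (lin_tensr b (@lin_id _ _))).
apply: eq_bigr => x _.
rewrite (sw1 _ (fun b1 b2 => (phi x.1 b1 : K) *: tens (b * b2) (x.2 * 1))).
  by rewrite !mulr1 pairing1r (linZ (lin_tensr b (@lin_id _ _))).
split=> b''.
  by apply: lin_scalel; apply: lin_phir; exact: lin_id.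
by apply: lin_scaler; apply: lin_tensl; apply: lin_mulr; exact: lin_id.
Qed.

(* Common normal form of both bracketings of a product of three pure tensors. *)
Let nf b a b' a' b'' a'' : tensor B A :=
  \sum_(u <- swa a) \sum_(u' <- swa u.2) \sum_(v <- swb b') \sum_(w <- swa a')
  \sum_(z <- swb b'') \sum_(y <- swb z.2)
    ((phi u.1 v.1 : K) * ((phi w.1 z.1 : K) * (phi u'.1 y.1 : K))) *:
      tens (b * v.2 * y.2) (u'.2 * w.2 * a'').

Let nfl b a b' a' b'' a'' :
  hmul (hmul (tens b a) (tens b' a')) (tens b'' a'') = nf b a b' a' b'' a''.
Proof.
rewrite heisenberg_mulE (lin_sumE _ _ _ (lin_heisenbergl _)).
apply: eq_bigr => u _.
rewrite (lin_sumE _ _ _ (lin_heisenbergl _)) [RHS]exchange_big /=.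
apply: eq_bigr => v _.
rewrite (linZ (lin_heisenbergl _)) heisenberg_mulE.
rewrite (swM _ (fun w1 w2 => \sum_(z <- swb b'')
   (phi w1 z.1 : K) *: tens (b * v.2 * z.2) (w2 * a''))); last first.
  split=> a1; apply: lin_big => y.
    by apply: lin_scalel; apply: lin_phil; exact: lin_id.
  by apply: lin_scaler; apply: lin_tensr; apply: lin_mull; exact: lin_id.
rewrite scaler_sumr; apply: eq_bigr => u' _.
rewrite scaler_sumr; apply: eq_bigr => w _.
pose f y1 y2 z := ((phi u.1 v.1 : K) * ((phi w.1 y1 : K) * (phi u'.1 y2 : K))) *:
      tens (b * v.2 * z) (u'.2 * w.2 * a'').
rewrite -[RHS](swA _ f) /f.
- rewrite scaler_sumr; apply: eq_bigr => z _.
  rewrite pairing_mull scaler_suml scaler_sumr.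
  by apply: eq_bigr => y _; rewrite scalerA.
- move=> y z; apply: lin_scalel => c s t.
  by rewrite (lin_phir w.1 (@lin_id _ _)) /GRing.scale /=; ring.
- move=> y z; apply: lin_scalel => c s t.
  by rewrite (lin_phir u'.1 (@lin_id _ _)) /GRing.scale /=; ring.
- move=> y z; apply: lin_scaler; apply: lin_tensl; apply: lin_mulr; exact: lin_id.
Qed.

Let nfr b a b' a' b'' a'' :
  hmul (tens b a) (hmul (tens b' a') (tens b'' a'')) = nf b a b' a' b'' a''.
Proof.
pose f u1 u1' u2 : tensor B A :=
  \sum_(v <- swb b') \sum_(w <- swa a') \sum_(z <- swb b'') \sum_(y <- swb z.2)
    ((phi u1 v.1 : K) * ((phi w.1 z.1 : K) * (phi u1' y.1 : K))) *:
      tens (b * v.2 * y.2) (u2 * w.2 * a'').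
have fA := swA HA f a.
rewrite -[RHS]/(\sum_(u <- swa a) \sum_(u' <- swa u.2) f u.1 u'.1 u'.2) -fA; first last.
- move=> u1 u1'; do 4 (apply: lin_big => ?).
  by apply: lin_scaler; apply: lin_tensr; do 2 apply: lin_mull; exact: lin_id.
- move=> u1 u1'; do 4 (apply: lin_big => ?).
  apply: lin_scalel => c s t.
  by rewrite (lin_phil _ (@lin_id _ _)) /GRing.scale /=; ring.
- move=> u1 u1'; do 4 (apply: lin_big => ?).
  apply: lin_scalel => c s t.
  by rewrite (lin_phil _ (@lin_id _ _)) /GRing.scale /=; ring.
rewrite heisenberg_mulE (lin_sumE _ _ _ (lin_heisenbergr _)).
transitivity (\sum_(w <- swa a') \sum_(z <- swb b'') \sum_(u <- swa a)
    \sum_(v <- swb b') \sum_(u' <- swa u.1) \sum_(y <- swb z.2)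
    ((phi u'.1 v.1 : K) * ((phi w.1 z.1 : K) * (phi u'.2 y.1 : K))) *:
      tens (b * v.2 * y.2) (u.2 * w.2 * a'')).
  apply: eq_bigr => w _.
  rewrite (lin_sumE _ _ _ (lin_heisenbergr _)); apply: eq_bigr => z _.
  rewrite (linZ (lin_heisenbergr _)) heisenberg_mulE scaler_sumr.
  apply: eq_bigr => u _.
  rewrite (swM _ (fun w1 w2 =>
     (phi u.1 w1 : K) *: tens (b * w2) (u.2 * (w.2 * a'')))); last first.
    split=> b1.
      by apply: lin_scalel; apply: lin_phir; exact: lin_id.
    by apply: lin_scaler; apply: lin_tensl; apply: lin_mulr; exact: lin_id.
  rewrite scaler_sumr; apply: eq_bigr => v _.
  rewrite scaler_sumr exchange_big /=; apply: eq_bigr => y _.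
  rewrite pairing_mulr scaler_suml scaler_sumr; apply: eq_bigr => u' _.
  by rewrite scalerA !mulrA; congr (_ *: _); ring.
rewrite /f.
under eq_bigr do rewrite exchange_big /=.
rewrite exchange_big /=; apply: eq_bigr => u _.
under eq_bigr do under eq_bigr do rewrite exchange_big /=.
under eq_bigr do rewrite exchange_big /=.
rewrite exchange_big /=; apply: eq_bigr => u' _.
under eq_bigr do rewrite exchange_big /=.
by rewrite exchange_big.
Qed.

Fact heisenberg_mulA : associative hmul.
Proof.
move=> s t r.
move: s; apply: tensor_eq.
- exact: lin_heisenbergl.
- by apply: (lin_comp (lin_heisenbergl _)); exact: lin_heisenbergl.
move=> b a; move: t; apply: tensor_eq.
- by apply: (lin_comp (lin_heisenbergr _)); exact: lin_heisenbergl.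
- by apply: (lin_comp (lin_heisenbergl _)); exact: lin_heisenbergr.
move=> b' a'; move: r; apply: tensor_eq.
- by apply: (lin_comp (lin_heisenbergr _)); exact: lin_heisenbergr.
- exact: lin_heisenbergr.
by move=> b'' a''; rewrite nfl nfr.
Qed.

Fact heisenberg_mulDl : left_distributive hmul +%R.
Proof. by move=> s t r; rewrite (linD (lin_heisenbergl r)). Qed.
Fact heisenberg_mulDr : right_distributive hmul +%R.
Proof. by move=> s t r; rewrite (linD (lin_heisenbergr s)). Qed.
Fact heisenberg_one_neq0 : tens 1 1 != 0 :> tensor B A.
Proof.
apply/eqP => h.
have hf : bilin (fun b a => (counit HB b : K) * (counit HA a : K) : K^o).
  split=> [a|b].
    by move=> c s t; rewrite linearP /GRing.scale /=; ring.
  by move=> c s t; rewrite linearP /GRing.scale /=; ring.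
have := tliftE hf 1 1; rewrite h (lin0 (tlift_lin hf)) !counit1 mulr1.
by move/eqP; rewrite eq_sym oner_eq0.
Qed.

(* The pairing is a phantom parameter selecting the product. *)
Definition heisenberg (_ : skewPairing HA HB) : Type := tensor B A.
Local Notation Hphi := (heisenberg phi).
HB.instance Definition _ := GRing.Lmodule.on Hphi.
HB.instance Definition _ := GRing.Zmodule_isNzRing.Build Hphi
  heisenberg_mulA heisenberg_mul1l heisenberg_mul1r
  heisenberg_mulDl heisenberg_mulDr heisenberg_one_neq0.
Fact heisenberg_scalAl (c : K) (s t : Hphi) : c *: (s * t) = (c *: s) * t.
Proof. exact/esym/(linZ (lin_heisenbergl t)). Qed.
Fact heisenberg_scalAr (c : K) (s t : Hphi) : c *: (s * t) = s * (c *: t).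
Proof. exact/esym/(linZ (lin_heisenbergr s)). Qed.
HB.instance Definition _ :=
  GRing.Lmodule_isLalgebra.Build K Hphi heisenberg_scalAl.
HB.instance Definition _ :=
  GRing.Lalgebra_isAlgebra.Build K Hphi heisenberg_scalAr.

Definition sharp (b : B) (a : A) : Hphi := tens b a.
End Heisenberg.

Section Coideal.
Context {K : fieldType} {A : algType K}.
Variables (H : hopfAlgebra A) (S : A -> Prop).

Definition left_coideal : Prop := forall x, x \in generatedb S ->
  exists t : tensor A (subalg S), tmap id val t = comul H x.

Lemma tmap_incl_lin : lin (tmap id val : tensor A (subalg S) -> tensor A A).
Proof. by apply: tmap_lin; [exact: lin_id | exact: lin_val]. Qed.

Lemma tmap_inclM (s t : tensor A (subalg S)) :
  tmap id val (tmul s t) = tmul (tmap id val s) (tmap id val t).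
Proof.
have hl := tmap_incl_lin.
move: s; apply: tensor_eq.
- by apply: (lin_comp hl); exact: lin_tmull.
- by apply: (lin_comp (lin_tmull _)).
move=> a x; move: t; apply: tensor_eq.
- by apply: (lin_comp hl); exact: lin_tmulr.
- by apply: (lin_comp (lin_tmulr _)).
move=> b y; rewrite tmulE.
have eA (c : A) (z : subalg S) : tmap id val (tens c z) = tens c (val z) :> tensor A A.
  by apply: tmapE; [exact: lin_id | exact: lin_val].
apply: (etrans (eA (a * b) (x * y))).
apply: (etrans _ (esym (congr2 (@tmul _ A A) (eA a x) (eA b y)))).
by rewrite tmulE rmorphM.
Qed.

Lemma left_coideal_gen :
  (forall x, S x -> exists t : tensor A (subalg S), tmap id val t = comul H x) ->
  left_coideal.
Proof.
have hl := tmap_incl_lin.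
move=> h x /generatedP; elim=> {x} [x /h //||x y _ [s hs] _ [t ht]|a x _ [s hs]
  |x y _ [s hs] _ [t ht]].
- exists (tens 1 1); rewrite comul1 (tmapE _ _ (@lin_id _ _) (lin_val (S := S))).
  by rewrite rmorph1.
- by exists (s + t); rewrite (linD hl) hs ht raddfD.
- by exists (a *: s); rewrite (linZ hl) hs linearZ.
- by exists (tmul s t); rewrite tmap_inclM hs ht comulM.
Qed.

Hypothesis hS : left_coideal.

(* The restriction of the coproduct to a left coideal subalgebra. It is
   unique because A (x) S -> A (x) A is injective (tmap_inj). *)
Definition coaction (x : subalg S) : tensor A (subalg S) :=
  projT1 (cid (hS (valP x))).

Lemma coactionK x : tmap id val (coaction x) = comul H (val x).
Proof. by rewrite /coaction; case: cid. Qed.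

Lemma lin_coaction : lin coaction.
Proof.
move=> a x y.
have inj := tmap_inj (@lin_id _ A) (@lin_val _ _ S) (@inj_id A) val_inj.
apply: inj.
by rewrite tmap_incl_lin !coactionK !linearP.
Qed.
End Coideal.

Section Braided.
Context {K : fieldType} {A B : algType K}.
Context {HA : hopfAlgebra A} {HB : hopfAlgebra B}.
Variable phi : skewPairing HA HB.

Definition schrodinger (a : A) (y : B) : B :=
  \sum_(b <- trep (comul HB y)) (phi a b.1 : K) *: b.2.

Context {SB : B -> Prop} {SA : A -> Prop}.
Hypotheses (hB : left_coideal HB SB) (hA : left_coideal HA SA).
Local Notation N := (subalg SB).
Local Notation P := (subalg SA).

Fact bilin_schr a : bilin (fun b1 b2 => (phi a b1 : K) *: b2 : B).
Proof.
split=> b.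
  by apply: lin_scalel; apply: lin_phir; exact: lin_id.
by apply: lin_scaler; exact: lin_id.
Qed.

Lemma lin_schrr a : lin (schrodinger a).
Proof. exact: (lin_sw HB (bilin_schr a) (@lin_id _ _)). Qed.
Lemma lin_schrl y : lin (schrodinger^~ y).
Proof.
apply: lin_big => b; apply: lin_scalel; apply: lin_phil; exact: lin_id.
Qed.

Fact schrodinger_stable a (y : N) : schrodinger a (val y) \in generatedb SB.
Proof.
have e : schrodinger a (val y) =
    \sum_(p <- trep (coaction hB y)) (phi a p.1 : K) *: val p.2.
  rewrite /schrodinger -(coactionK hB y) /tmap.
  have := trep_sum (bilin_schr a) [seq (p.1, val p.2) | p <- trep (coaction hB y)].
  by rewrite !big_map.
rewrite e; apply: rpred_sum => p _; apply: rpredZ; exact: (valP p.2).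
Qed.

Definition schr_act (a : A) (y : N) : N := Subalg (schrodinger_stable a y).

Definition braided_mul (s t : tensor N P) : tensor N P :=
  \sum_(x <- trep s) \sum_(y <- trep t) \sum_(e <- trep (coaction hA x.2))
    tens (x.1 * schr_act e.1 y.1) (e.2 * y.2).

Lemma lin_actr a : lin (schr_act a).
Proof. by move=> c x y; apply: val_inj; rewrite linearP /= lin_schrr. Qed.
Lemma lin_actl y : lin (schr_act^~ y).
Proof. by move=> c a b; apply: val_inj; rewrite linearP /= lin_schrl. Qed.

Let core (f : N) (e : P) (g : N) (h : P) : tensor N P :=
  \sum_(u <- trep (coaction hA e)) tens (f * schr_act u.1 g) (u.2 * h).

Let core1 e g h : lin (fun f => core f e g h).
Proof.
by apply: lin_big => u; apply: lin_tensl; apply: lin_mull; exact: lin_id.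
Qed.
Let core2b f g h : bilin (fun a (e : P) => tens (f * schr_act a g) (e * h)).
Proof.
split=> a.
  by apply: lin_tensl; apply: lin_mulr; exact: lin_actl.
by apply: lin_tensr; apply: lin_mull; exact: lin_id.
Qed.
Let core2 f g h : lin (fun e => core f e g h).
Proof. exact: (lin_trep (core2b f g h) (lin_coaction hA)). Qed.
Let core3 f e h : lin (fun g => core f e g h).
Proof.
by apply: lin_big => u; apply: lin_tensl; apply: lin_mulr; exact: lin_actr.
Qed.
Let core4 f e g : lin (fun h => core f e g h).
Proof.
by apply: lin_big => u; apply: lin_tensr; apply: lin_mulr; exact: lin_id.
Qed.

Lemma braided_mulE f e g h :
  braided_mul (tens f e) (tens g h) =
  \sum_(u <- trep (coaction hA e)) tens (f * schr_act u.1 g) (u.2 * h).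
Proof.
have hb1 : bilin (fun u v => \sum_(y <- trep (tens g h)) core u v y.1 y.2).
  by split=> ?; apply: lin_big => ?.
rewrite /braided_mul; have /= -> := trep_tens hb1 f e.
have hb2 : bilin (core f e) by split.
by have /= -> := trep_tens hb2 g h.
Qed.

Lemma lin_braidedl t : lin (braided_mul^~ t).
Proof.
have hb1 : bilin (fun u v => \sum_(y <- trep t) core u v y.1 y.2).
  by split=> ?; apply: lin_big => ?.
exact: (lin_trep hb1 (@lin_id _ _)).
Qed.
Lemma lin_braidedr s : lin (braided_mul s).
Proof.
apply: lin_big => x.
have hb2 : bilin (core x.1 x.2) by split.
exact: (lin_trep hb2 (@lin_id _ _)).
Qed.

Definition braided_incl : tensor N P -> heisenberg phi := tmap val val.

Lemma lin_incl : lin braided_incl.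
Proof. by apply: tmap_lin; exact: lin_val. Qed.

Lemma braided_inclE f e : braided_incl (tens f e) = sharp phi (val f) (val e).
Proof. by apply: tmapE; exact: lin_val. Qed.

Lemma braided_incl_inj : injective braided_incl.
Proof. by apply: tmap_inj => //; [exact: lin_val..| exact: val_inj|exact: val_inj]. Qed.

Lemma braided_inclM s t :
  braided_incl (braided_mul s t) = braided_incl s * braided_incl t.
Proof.
have hl := lin_incl.
move: s; apply: tensor_eq.
- by apply: (lin_comp hl); exact: lin_braidedl.
- by apply: (lin_comp (lin_heisenbergl _ _)).
move=> f e; move: t; apply: tensor_eq.
- by apply: (lin_comp hl); exact: lin_braidedr.
- by apply: (lin_comp (lin_heisenbergr _ _)).
move=> g h; rewrite braided_mulE (lin_sumE _ _ _ hl).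
apply: (etrans _ (esym (congr2 (heisenberg_mul phi)
  (braided_inclE f e) (braided_inclE g h)))).
apply: (etrans _ (esym (heisenberg_mulE phi (val f) (val e) (val g) (val h)))).
pose F (a : A) (e : A) : tensor B A := tens (val f * schrodinger a (val g)) (e * val h).
have hF : bilin F.
  split=> a.
    by apply: lin_tensl; apply: lin_mulr; exact: lin_schrl.
  by apply: lin_tensr; apply: lin_mull; exact: lin_id.
transitivity (\sum_(u <- trep (comul HA (val e))) F u.1 u.2).
  rewrite -(coactionK hA e) /tmap.
  have := trep_sum hF [seq (p.1, val p.2) | p <- trep (coaction hA e)].
  rewrite !big_map => ->; apply: eq_bigr => u _.
  by rewrite braided_inclE /sharp !rmorphM.
apply: eq_bigr => u _; rewrite /F /schrodinger mulr_sumr.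
rewrite (lin_sumE _ _ _ (lin_tensl _ (@lin_id _ _))); apply: eq_bigr => b _.
by rewrite -scalerAr (linZ (tensP_l _)).
Qed.

Lemma braided_incl1 : braided_incl (tens 1 1) = 1.
Proof. by rewrite braided_inclE !rmorph1. Qed.

Fact braided_mulA : associative braided_mul.
Proof.
by move=> s t r; apply: braided_incl_inj; rewrite !braided_inclM mulrA.
Qed.
Fact braided_mul1l : left_id (tens 1 1) braided_mul.
Proof.
by move=> s; apply: braided_incl_inj; rewrite braided_inclM braided_incl1 mul1r.
Qed.
Fact braided_mul1r : right_id (tens 1 1) braided_mul.
Proof.
by move=> s; apply: braided_incl_inj; rewrite braided_inclM braided_incl1 mulr1.
Qed.
Fact braided_mulDl : left_distributive braided_mul +%R.
Proof. by move=> s t r; rewrite (linD (lin_braidedl r)). Qed.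
Fact braided_mulDr : right_distributive braided_mul +%R.
Proof. by move=> s t r; rewrite (linD (lin_braidedr s)). Qed.
Fact braided_one_neq0 : tens 1 1 != 0 :> tensor N P.
Proof.
apply/eqP => h; have := braided_incl1; rewrite h (lin0 lin_incl).
by move/eqP; rewrite eq_sym oner_eq0.
Qed.

Definition braided_tensor (_ : skewPairing HA HB) (_ : left_coideal HB SB)
  (_ : left_coideal HA SA) : Type := tensor N P.
Local Notation T := (braided_tensor phi hB hA).
HB.instance Definition _ := GRing.Lmodule.on T.
HB.instance Definition _ := GRing.Zmodule_isNzRing.Build T
  braided_mulA braided_mul1l braided_mul1r
  braided_mulDl braided_mulDr braided_one_neq0.
Fact braided_scalAl (c : K) (s t : T) : c *: (s * t) = (c *: s) * t.
Proof. exact/esym/(linZ (lin_braidedl t)). Qed.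
Fact braided_scalAr (c : K) (s t : T) : c *: (s * t) = s * (c *: t).
Proof. exact/esym/(linZ (lin_braidedr s)). Qed.
HB.instance Definition _ :=
  GRing.Lmodule_isLalgebra.Build K T braided_scalAl.
HB.instance Definition _ :=
  GRing.Lalgebra_isAlgebra.Build K T braided_scalAr.
End Braided.

Record lieAlgebra (K : fieldType) := LieAlgebra {
  lie_sort :> vectType K;
  bracket : lie_sort -> lie_sort -> lie_sort;
  bracket_bilin : bilin bracket;
  bracketxx : forall x, bracket x x = 0;
  jacobi : forall x y z,
    bracket x (bracket y z) + bracket y (bracket z x) +
    bracket z (bracket x y) = 0
}.

Section LieAlgebra.
Variables (K : fieldType) (g : lieAlgebra K).
Implicit Types (I U h : {vspace g}) (x y : g).

(* The span of all brackets [u, v] with u in U and v in V. *)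
Definition lie_prod U V : {vspace g} :=
  <<[seq bracket u v | u <- vbasis U, v <- vbasis V]>>%VS.

Definition lie_ideal I : Prop := forall x y, y \in I -> bracket x y \in I.

Definition derived_series k U : {vspace g} := iter k (fun V => lie_prod V V) U.
Definition lower_central_series k U : {vspace g} := iter k (lie_prod U) U.

Definition lie_solvable U : Prop := exists k, derived_series k U = 0%VS.
Definition lie_nilpotent U : Prop := exists k, lower_central_series k U = 0%VS.

Definition semisimple : Prop :=
  forall I, lie_ideal I -> lie_solvable I -> I = 0%VS.

Definition cartan_subalgebra h : Prop :=
  [/\ (lie_prod h h <= h)%VS, lie_nilpotent h
    & forall x, (forall y, y \in h -> bracket x y \in h) -> x \in h].

Section Roots.
Variable h : {vspace g}.
Local Notation dual := 'Hom(subvs_of h, K^o).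

Definition root_vector (al : dual) (x : g) : Prop :=
  forall t : subvs_of h, bracket (vsval t) x = (al t : K) *: x.

(* For a semisimple Lie algebra a Cartan subalgebra acts diagonalizably, so
   honest (not generalized) weight vectors suffice. *)
Definition is_root (al : dual) : Prop :=
  al != 0 /\ exists2 x, x != 0 & root_vector al x.

Definition simple_roots n (al : 'I_n -> dual) : Prop :=
  [/\ forall i, is_root (al i), free [seq al i | i <- enum 'I_n]
    & forall be, is_root be -> exists c : 'I_n -> nat,
        be = \sum_i al i *+ c i \/ be = - \sum_i al i *+ c i].

(* The element of [g_al, g_-al] on which al takes the value 2. *)
Definition is_coroot (al : dual) (t : subvs_of h) : Prop :=
  (al t = 2%:R :> K) /\ exists x y,
    [/\ root_vector al x, root_vector (- al) y & vsval t = bracket x y].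
End Roots.

(* a_ij = al_j (co_i) = 2 (al_i, al_j) / (al_i, al_i), so that d_i a_ij is
   symmetric for d_i proportional to (al_i, al_i). *)
Definition cartan_matrix n (a : 'M[int]_n) : Prop :=
  exists h (al : 'I_n -> 'Hom(subvs_of h, K^o)) (co : 'I_n -> subvs_of h),
    [/\ cartan_subalgebra h, simple_roots al, forall i, is_coroot (al i) (co i)
      & forall i j, al j (co i) = (a i j)%:~R :> K].
End LieAlgebra.

Section FreeAlgebra.
Variables (K : fieldType) (I : choiceType).

Definition freealg : Type := {malg K[{fmonom I}]}.
HB.instance Definition _ := GRing.Lalgebra.on freealg.

Fact freealg_scalAr (c : K) (x y : freealg) : c *: (x * y) = x * (c *: y).
Proof.
have comC (z : freealg) : z * (c%:MP : freealg) = c *: z.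
  rewrite -mul_malgC [z]monalgE mulr_suml mulr_sumr.
  apply: eq_bigr => k _; rewrite !malgM_def !fgmulUU mulrC.
  by congr mkmalgU; rewrite mulm1 mul1m.
by rewrite -(comC (x * y)) -mulrA comC.
Qed.
HB.instance Definition _ :=
  GRing.Lalgebra_isAlgebra.Build K freealg freealg_scalAr.

Definition fgen (i : I) : freealg := << fmu i >>.

Variable c : I -> K.
(* Characters of the free algebra, used to see that the ideals of relations
   below are proper. *)
Definition feval_monom (m : {fmonom I}) : K := \prod_(i <- (m : seq I)) c i.
Fact feval_monom_morph : mmorphism feval_monom.
Proof.
by split=> [x y|]; rewrite /feval_monom ?fmM ?big_cat // fm1 big_nil.
Qed.
HB.instance Definition _ :=
  isMultiplicative.Build {fmonom I} K feval_monom feval_monom_morph.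

Definition feval : freealg -> K := mmap idfun feval_monom.
HB.instance Definition _ := GRing.RMorphism.on feval.

Lemma fevalZ a x : feval (a *: x) = a * feval x.
Proof. exact: mmap_is_linear. Qed.
Lemma feval_gen i : feval (fgen i) = c i.
Proof. by rewrite /feval mmapU mul1r /feval_monom fmU big_seq1. Qed.

Lemma feval_comm x y : feval (x * y - y * x) = 0.
Proof. by rewrite rmorphB !rmorphM mulrC subrr. Qed.

Lemma feval_proper (S : freealg -> Prop) :
  (forall x, S x -> feval x = 0) -> ~ ideal S 1.
Proof.
move=> hS h1; have : feval 1 = 0; last first.
  by move/eqP; rewrite rmorph1 oner_eq0.
move: (1 : freealg) h1 => x.
elim=> [_ [u [v [s [hs ->]]]]||u v _ hu _ hv|a v _ hv].
- by rewrite !rmorphM /= (hS s hs) mulr0 mul0r.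
- exact: rmorph0.
- by rewrite rmorphD /= hu hv addr0.
- by rewrite fevalZ hv mulr0.
Qed.
End FreeAlgebra.
Arguments fgen {K I} i.

Section SkewPrimitive.
Context {K : fieldType}.

Lemma tmulA (A B : algType K) (x y z : tensor A B) :
  tmul x (tmul y z) = tmul (tmul x y) z.
Proof.
move: x; apply: tensor_eq.
- exact: lin_tmull.
- by apply: (lin_comp (lin_tmull _)); exact: lin_tmull.
move=> x1 x2; move: y; apply: tensor_eq.
- by apply: (lin_comp (lin_tmulr _)); exact: lin_tmull.
- by apply: (lin_comp (lin_tmull _)); exact: lin_tmulr.
move=> y1 y2; move: z; apply: tensor_eq.
- by apply: (lin_comp (lin_tmulr _)); exact: lin_tmulr.
- exact: lin_tmulr.
by move=> z1 z2; rewrite !tmulE !mulrA.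
Qed.
Lemma tmul1l (A B : algType K) (x : tensor A B) : tmul (tens 1 1) x = x.
Proof.
move: x; apply: tensor_eq; [exact: lin_tmulr|exact: lin_id|] => x y.
by rewrite tmulE !mul1r.
Qed.
Lemma tmul1r (A B : algType K) (x : tensor A B) : tmul x (tens 1 1) = x.
Proof.
move: x; apply: tensor_eq; [exact: lin_tmull|exact: lin_id|] => x y.
by rewrite tmulE !mulr1.
Qed.

Variables (A : algType K) (H : hopfAlgebra A).

Lemma comul_twist (w wV e : A) (c : K) : w * wV = 1 -> wV * w = 1 ->
  comul H w = tens w w -> comul H e = tens e w + tens 1 e ->
  comul H (c *: (wV * e)) = tens (c *: (wV * e)) 1 + tens wV (c *: (wV * e)).
Proof.
move=> wwV wVw hw he.
have hwV : comul H wV = tens wV wV.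
  rewrite -[RHS]tmul1r -(comul1 H) -wwV comulM hw tmulA tmulE.
  by rewrite wVw tmul1l.
rewrite linearZ /= comulM hwV he (linD (lin_tmulr _)).
rewrite (tmulE wV e wV w) (tmulE wV 1 wV e) mulr1 wVw scalerDr.
by rewrite (linZ (tensP_l _)) (linZ (tensP_r _)).
Qed.

Lemma left_coideal_skew (S : A -> Prop) :
  (forall x, S x -> exists g, comul H x = tens x 1 + tens g x) ->
  left_coideal H S.
Proof.
move=> hS; apply: left_coideal_gen => x Sx.
have h : x \in generatedb S by apply/generatedP/generated_base.
have [g e] := hS x Sx.
exists (tens x 1 + tens g (Subalg h)).
rewrite (linD (tmap_incl_lin (S := S))) e.
by congr (_ + _); apply: tmapE; (exact: lin_id || exact: lin_val).
Qed.
End SkewPrimitive.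

Section QNumbers.
Variable K : fieldType.
Definition qint (v : K) (k : nat) : K := \sum_(i < k) v ^+ i.
Definition qfact (v : K) (k : nat) : K := \prod_(1 <= i < k.+1) qint v i.
Definition qbin (v : K) (m k : nat) : K :=
  qfact v m / (qfact v k * qfact v (m - k)).
End QNumbers.

Section QuantumGroup.
Variables (K : fieldType) (n : nat) (a : 'M[int]_n) (d : 'I_n -> nat) (r s : K).
Implicit Types i j : 'I_n.

(* The Euler form on simple roots. *)
Definition euler i j : int :=
  if (i < j)%N then (d i)%:Z * a i j else if i == j then (d i)%:Z else 0.

Definition r_ i : K := r ^+ d i.
Definition s_ i : K := s ^+ d i.

(* 1 - a_ij is a natural number for i != j since then a_ij <= 0. *)
Definition serre_deg i j : nat := absz (1 - a i j).

(* (-1)^k times the Gaussian binomial times c_ij^k. *)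
Definition serre_coef i j (k : nat) : K :=
  (-1) ^+ k * qbin (r_ i / s_ i) (serre_deg i j) k *
  ((r_ i / s_ i) ^+ ((k * k.-1) %/ 2) *
   r ^ (k%:Z * euler j i) * s ^ (- (k%:Z * euler i j))).

(* inl i stands for e_i (resp. f_i); inr (i, true) and inr (i, false) stand
   for omega'_i and its inverse (resp. omega_i and its inverse). *)
Definition qgen : choiceType := ('I_n + 'I_n * bool)%type.
Local Notation F := (freealg K qgen).
Definition gen_x i : F := fgen (inl i : qgen).
Definition gen_w i (b : bool) : F := fgen (inr (i, b) : qgen).

Inductive Uge_rel : F -> Prop :=
| Uge_comm i b j c :
    Uge_rel (gen_w i b * gen_w j c - gen_w j c * gen_w i b)
| Uge_inv i : Uge_rel (gen_w i true * gen_w i false - 1)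
| Uge_conj i j :
    Uge_rel (gen_w i true * gen_x j * gen_w i false
             - (r ^ (- euler i j) * s ^ euler j i) *: gen_x j)
| Uge_serre i j : i != j ->
    Uge_rel (\sum_(k < (serre_deg i j).+1) serre_coef i j k *:
      (gen_x i ^+ (serre_deg i j - k) * gen_x j * gen_x i ^+ k)).

Inductive Ule_rel : F -> Prop :=
| Ule_comm i b j c :
    Ule_rel (gen_w i b * gen_w j c - gen_w j c * gen_w i b)
| Ule_inv i : Ule_rel (gen_w i true * gen_w i false - 1)
| Ule_conj i j :
    Ule_rel (gen_w i true * gen_x j * gen_w i false
             - (r ^ (- euler j i) * s ^ euler i j) *: gen_x j)
| Ule_serre i j : i != j ->
    Ule_rel (\sum_(k < (serre_deg i j).+1) serre_coef i j k *:
      (gen_x i ^+ k * gen_x j * gen_x i ^+ (serre_deg i j - k))).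

Fact Uge_proper : ~ ideal Uge_rel 1.
Proof.
apply: (feval_proper (c := fun g : qgen => if g is inl _ then 0 else 1)) => _ [i b j c|i|i j|i j ij].
- exact: feval_comm.
- by rewrite rmorphB !rmorphM rmorph1 /= /gen_w !feval_gen mulr1 subrr.
- by rewrite rmorphB !rmorphM /= fevalZ /= /gen_w /gen_x !feval_gen !(mulr0, mul0r) subrr.
rewrite rmorph_sum /= big1 // => k _.
by rewrite fevalZ !rmorphM /gen_x /= feval_gen !(mulr0, mul0r).
Qed.
Fact Ule_proper : ~ ideal Ule_rel 1.
Proof.
apply: (feval_proper (c := fun g : qgen => if g is inl _ then 0 else 1)) => _ [i b j c|i|i j|i j ij].
- exact: feval_comm.
- by rewrite rmorphB !rmorphM rmorph1 /= /gen_w !feval_gen mulr1 subrr.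
- by rewrite rmorphB !rmorphM /= fevalZ /= /gen_w /gen_x !feval_gen !(mulr0, mul0r) subrr.
rewrite rmorph_sum /= big1 // => k _.
by rewrite fevalZ !rmorphM /gen_x /= feval_gen !(mulr0, mul0r).
Qed.

Definition Uge : Type := quotalg Uge_proper.
HB.instance Definition _ := GRing.Algebra.on Uge.
Definition Ule : Type := quotalg Ule_proper.
HB.instance Definition _ := GRing.Algebra.on Ule.

Definition ge_e i : Uge := qcls Uge_proper (gen_x i).
Definition ge_w i : Uge := qcls Uge_proper (gen_w i true).
Definition ge_wV i : Uge := qcls Uge_proper (gen_w i false).
Definition le_f i : Ule := qcls Ule_proper (gen_x i).
Definition le_w i : Ule := qcls Ule_proper (gen_w i true).
Definition le_wV i : Ule := qcls Ule_proper (gen_w i false).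

(* Uge and Ule are generated by the elements on which the structure maps are
   prescribed, so that the Hopf structures, and then the pairing, are uniquely
   determined by the fields of the following three records. *)
Record UgeHopf := {
  Uge_hopf :> hopfAlgebra Uge;
  ge_comul_w : forall i, comul Uge_hopf (ge_w i) = tens (ge_w i) (ge_w i);
  ge_counit_w : forall i, counit Uge_hopf (ge_w i) = 1;
  ge_comul_e : forall i,
    comul Uge_hopf (ge_e i) = tens (ge_e i) (ge_w i) + tens 1 (ge_e i);
  ge_counit_e : forall i, counit Uge_hopf (ge_e i) = 0;
  ge_antipode_e : forall i, antipode Uge_hopf (ge_e i) = - (ge_e i * ge_wV i)
}.

Record UleHopf := {
  Ule_hopf :> hopfAlgebra Ule;
  le_comul_w : forall i, comul Ule_hopf (le_w i) = tens (le_w i) (le_w i);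
  le_counit_w : forall i, counit Ule_hopf (le_w i) = 1;
  le_comul_f : forall i,
    comul Ule_hopf (le_f i) = tens (le_f i) 1 + tens (le_w i) (le_f i);
  le_counit_f : forall i, counit Ule_hopf (le_f i) = 0;
  le_antipode_f : forall i, antipode Ule_hopf (le_f i) = - (le_wV i * le_f i)
}.

Record rsPairing (HA : UgeHopf) (HB : UleHopf) := {
  rs_pairing :> skewPairing HA HB;
  pairing_ef : forall i j,
    rs_pairing (ge_e i) (le_f j) = (i == j)%:R / (s_ i - r_ i);
  pairing_ww : forall i j,
    rs_pairing (ge_w i) (le_w j) = r ^ euler i j * s ^ (- euler j i);
  pairing_ew : forall i j, rs_pairing (ge_e i) (le_w j) = 0;
  pairing_wf : forall i j, rs_pairing (ge_w i) (le_f j) = 0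
}.

Definition ge_e' i : Uge := (s_ i - r_ i) *: (ge_wV i * ge_e i).

Definition Bplus_gen (x : Uge) : Prop := exists i, x = ge_e' i.
Definition Bminus_gen (y : Ule) : Prop := exists i, y = le_f i.
Definition Bplus := subalg Bplus_gen.
Definition Bminus := subalg Bminus_gen.

Section Coideals.
Variables (HA : UgeHopf) (HB : UleHopf).

Lemma ge_w_wV i : ge_w i * ge_wV i = 1.
Proof.
rewrite -qclsM -[1]/(qcls Uge_proper 1); apply/clsP/span_base.
by exists 1, 1, (gen_w i true * gen_w i false - 1); split; [exact: Uge_inv | rewrite mul1r mulr1].
Qed.
Lemma ge_wV_w i : ge_wV i * ge_w i = 1.
Proof.
rewrite -[RHS](ge_w_wV i) -!qclsM; apply/clsP/span_base.
by exists 1, 1, (gen_w i false * gen_w i true - gen_w i true * gen_w i false);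
  split; [exact: Uge_comm | rewrite mul1r mulr1].
Qed.

Lemma ge_comul_e' i :
  comul HA (ge_e' i) = tens (ge_e' i) 1 + tens (ge_wV i) (ge_e' i).
Proof.
exact: (comul_twist _ (ge_w_wV i) (ge_wV_w i) (ge_comul_w HA i) (ge_comul_e HA i)).
Qed.

Lemma Bplus_coideal : left_coideal HA Bplus_gen.
Proof.
by apply: left_coideal_skew => _ [i ->]; exists (ge_wV i); exact: ge_comul_e'.
Qed.

Lemma Bminus_coideal : left_coideal HB Bminus_gen.
Proof.
by apply: left_coideal_skew => _ [i ->]; exists (le_w i); exact: le_comul_f.
Qed.

Variable phi : rsPairing HA HB.

Definition BtensorB : Type := braided_tensor phi Bminus_coideal Bplus_coideal.
HB.instance Definition _ := GRing.Algebra.on BtensorB.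

Definition Btens (f : Bminus) (e : Bplus) : BtensorB := tens f e.

(* b # a is [sharp phi b a]; the two factors embed by b # 1 and 1 # a. *)
Definition W_gen (x : heisenberg phi) : Prop :=
  exists i, x = sharp phi (le_f i) 1 \/ x = sharp phi 1 (ge_e' i).
Definition Wrs := subalg W_gen.
HB.instance Definition _ := GRing.Algebra.on Wrs.
End Coideals.
End QuantumGroup.

(* Main.v *)
(* The Heisenberg double is the tensor product of its two factors as a vector
   space, with (b # 1)(1 # a) = b # a, so the inclusions of B^- and B^+ induce
   an injective algebra morphism from the braided tensor product into it. Its
   image is a subalgebra which contains the generators of W and lies in W,
   hence is W. *)
Require Import Defs.
From HB Require Import structures.
From mathcomp Require Import all_boot all_order all_algebra.
From mathcomp Require Import boolp reals complex.
Set Implicit Arguments.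
Unset Strict Implicit.
Unset Printing Implicit Defensive.
Import GRing.Theory Num.Theory.
Local Open Scope ring_scope.
Local Open Scope complex_scope.

Section Corestriction.
Context {K : fieldType} {A B : algType K}.
Variables (S : B -> Prop) (f : {lrmorphism A -> B}).
Hypothesis fS : forall x, f x \in generatedb S.

Definition corestr (x : A) : subalg S := Subalg (fS x).

Fact corestr_linear : linear corestr.
Proof. by move=> c x y; apply: val_inj; rewrite /= !linearP. Qed.
Fact corestr_monoid_morphism : monoid_morphism corestr.
Proof.
split=> [|x y]; apply: val_inj; first by rewrite /= rmorph1.
by rewrite /= rmorphM.
Qed.
HB.instance Definition _ :=
  GRing.isLinear.Build K A (subalg S) _ corestr corestr_linear.
HB.instance Definition _ :=
  GRing.isMonoidMorphism.Build A (subalg S) corestr corestr_monoid_morphism.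

Hypothesis f_gen : forall y, S y -> exists x, f x = y.

(** The image of an algebra morphism is a subalgebra, so it contains everything generated by
    elements it contains. *)
Lemma generated_image y : generated S y -> exists x, f x = y.
Proof.
elim=> {y} [y /f_gen //||_ _ _ [x <-] _ [y <-]|c _ _ [x <-]
  |_ _ _ [x <-] _ [y <-]].
- by exists 1; rewrite rmorph1.
- by exists (x + y); rewrite rmorphD.
- by exists (c *: x); rewrite linearZ.
- by exists (x * y); rewrite rmorphM.
Qed.

Lemma corestr_bij : injective f -> bijective corestr.
Proof.
move=> f_inj; have ex (y : subalg S) := cid (generated_image (subalg_gen y)).
have gK y : corestr (projT1 (ex y)) = y.
  by apply: val_inj; rewrite /=; case: (ex y).
(* The chosen preimages give a right inverse by [gK]; injectivity of [f] makes it a left inverse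
   too. *)
exists (fun y => projT1 (ex y)) => // x; apply: f_inj.
by have /(congr1 val) := gK (corestr x).
Qed.
End Corestriction.

Section Sharp.
Context {K : fieldType} {A B : algType K}.
Variables (HA : hopfAlgebra A) (HB : hopfAlgebra B) (phi : skewPairing HA HB).

(** Since the coproduct of 1 is 1 ⊗ 1 and pairing with 1 is the counit, the sum over the coproduct
    of [b'] collapses by the counit axiom. *)
Lemma sharpMl b b' a' : sharp phi b 1 * sharp phi b' a' = sharp phi (b * b') a'.
Proof.
rewrite [LHS](heisenberg_mulE phi b 1 b' a').
rewrite (sw1 _ (fun a1 a2 => \sum_(y <- trep (comul HB b'))
   (phi a1 y.1 : K) *: tens (b * y.2) (a2 * a'))); last first.
  split=> a; apply: lin_big => y.
    by apply: lin_scalel; apply: lin_phil; exact: lin_id.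
  by apply: lin_scaler; apply: lin_tensr; apply: lin_mull; exact: lin_id.
rewrite -[in RHS](counitl HB b') /sharp.
rewrite (lin_sumE _ _ _ (lin_tensl a' (lin_mulr b (@lin_id _ _)))).
apply: eq_bigr => y _; rewrite mul1r pairing1l.
by rewrite (linZ (lin_tensl a' (lin_mulr b (@lin_id _ _)))).
Qed.

Lemma sharp_split b a : sharp phi b 1 * sharp phi 1 a = sharp phi b a.
Proof. by rewrite sharpMl mulr1. Qed.

(** The mirror argument: here the counit axiom is applied to [a]. *)
Lemma sharpMr a a' : sharp phi 1 a * sharp phi 1 a' = sharp phi 1 (a * a').
Proof.
rewrite [LHS](heisenberg_mulE phi 1 a 1 a') -[in RHS](counitl HA a) /sharp.
rewrite (lin_sumE _ _ _ (lin_tensr 1 (lin_mull a' (@lin_id _ _)))).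
apply: eq_bigr => x _.
rewrite (sw1 HB (fun b1 b2 => (phi x.1 b1 : K) *: tens (1 * b2) (x.2 * a'))).
  by rewrite mulr1 pairing1r (linZ (lin_tensr 1 (lin_mull a' (@lin_id _ _)))).
split=> b.
  by apply: lin_scalel; apply: lin_phir; exact: lin_id.
by apply: lin_scaler; apply: lin_tensl; apply: lin_mulr; exact: lin_id.
Qed.

Context {SB : B -> Prop} {SA : A -> Prop}.

(** Splitting [sharp phi b a] lets the two factors be treated separately; each embeds
    multiplicatively, so induction on how it is generated applies. *)
Lemma sharp_generated (S : heisenberg phi -> Prop) b a :
  (forall y, SB y -> S (sharp phi y 1)) -> (forall x, SA x -> S (sharp phi 1 x)) ->
  generated SB b -> generated SA a -> sharp phi b a \in generatedb S.
Proof.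
move=> hB hA gb ga; rewrite -sharp_split; apply/generatedP/generatedM.
  elim: gb => {b} [y /hB|||c y _|y z _ hy _ hz].
  - exact: generated_base.
  - exact: generated1.
  - by move=> y z _ hy _ hz; rewrite /sharp (linD (tensP_l _)); exact: generatedD.
  - by move=> hy; rewrite /sharp (linZ (tensP_l _)); exact: generatedZ.
  - by rewrite -sharpMl; exact: generatedM.
elim: ga => {a} [x /hA|||c x _|x y _ hx _ hy].
- exact: generated_base.
- exact: generated1.
- by move=> x y _ hx _ hy; rewrite /sharp (linD (tensP_r _)); exact: generatedD.
- by move=> hx; rewrite /sharp (linZ (tensP_r _)); exact: generatedZ.
- by rewrite -sharpMr; exact: generatedM.
Qed.

Hypotheses (hB : left_coideal HB SB) (hA : left_coideal HA SA).
Local Notation T := (braided_tensor phi hB hA).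

(** Retyping [braided_incl] with the algebra [T] as source allows the morphism structures to be
    attached. *)
Definition braided_emb : T -> heisenberg phi :=
  @braided_incl K A B HA HB phi SB SA.

Fact braided_emb_linear : linear braided_emb.
Proof. exact: lin_incl. Qed.
Fact braided_emb_monoid_morphism : monoid_morphism braided_emb.
Proof. by split; [exact: braided_incl1 | exact: braided_inclM]. Qed.
HB.instance Definition _ :=
  GRing.isLinear.Build K T (heisenberg phi) _ braided_emb braided_emb_linear.
HB.instance Definition _ := GRing.isMonoidMorphism.Build T (heisenberg phi)
  braided_emb braided_emb_monoid_morphism.

Lemma braided_emb_tens (f : subalg SB) (e : subalg SA) :
  braided_emb (tens f e) = sharp phi (val f) (val e).
Proof. exact: braided_inclE. Qed.

(** The two directions of the hypothesis on [S] serve the two inclusions: from right to left it puts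
    the image of [braided_emb] inside the subalgebra, from left to right it puts the generators
    inside the image. *)
Lemma braided_tensor_generated (S : heisenberg phi -> Prop) :
  (forall x, S x <-> (exists2 y, SB y & x = sharp phi y 1) \/
                     (exists2 z, SA z & x = sharp phi 1 z)) ->
  exists F : {lrmorphism T -> subalg S}, bijective F /\
    forall f e, val (F (tens f e)) = sharp phi (val f) 1 * sharp phi 1 (val e).
Proof.
move=> SE.
have embS t : braided_emb t \in generatedb S.
  move: t; apply: tensor_ind => [f e||t u ht hu].
  - rewrite braided_emb_tens; apply: sharp_generated.
    + by move=> y hy; apply/SE; left; exists y.
    + by move=> z hz; apply/SE; right; exists z.
    + exact: subalg_gen.
    + exact: subalg_gen.
  - by rewrite raddf0 rpred0.
  - by rewrite raddfD rpredD.
have emb_gen x : S x -> exists t, braided_emb t = x.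
  case/SE=> [[y hy ->]|[z hz ->]].
    (* The preimages of the generators are y ⊗ 1 and, below, 1 ⊗ z. *)
    exists (tens (Subalg (introT (generatedP _ _) (generated_base hy))) 1).
    by rewrite braided_emb_tens rmorph1.
  exists (tens 1 (Subalg (introT (generatedP _ _) (generated_base hz)))).
  by rewrite braided_emb_tens rmorph1.
exists (corestr embS : {lrmorphism T -> subalg S}); split.
  by apply: corestr_bij => //; exact: braided_incl_inj.
by move=> f e; rewrite sharp_split; exact: braided_emb_tens.
Qed.
End Sharp.

Theorem proposition4p1 (R : realType) (g : lieAlgebra R[i]) (n : nat)
  (a : 'M[int]_n) (d : 'I_n -> nat) (r s : R[i])
  (g_semisimple : semisimple g)
  (a_cartan : cartan_matrix g a)
  (d_gt0 : forall i, (0 < d i)%N)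
  (d_coprime : (\big[gcdn/0]_(i < n) d i)%N = 1%N)
  (d_sym : forall i j, (d i)%:Z * a i j = (d j)%:Z * a j i)
  (r_neq0 : r != 0) (s_neq0 : s != 0)
  (rs_nroot1 : forall k : nat, (0 < k)%N -> (r / s) ^+ k != 1)
  (HA : UgeHopf a d r s) (HB : UleHopf a d r s) (phi : rsPairing HA HB) :
  exists F : {lrmorphism BtensorB phi -> Wrs phi},
    bijective F /\
    forall (f : Bminus a d r s) (e : Bplus a d r s),
      val (F (Btens phi f e)) = sharp phi (val f) 1 * sharp phi 1 (val e).
Proof.
(* It remains to match [W_gen], where one index covers both kinds of generators, with the union of
   [Bminus_gen] and [Bplus_gen]. *)
apply: braided_tensor_generated => x; split.
  by case=> i [->|->]; [left; exists (le_f a d r s i) | right; exists (ge_e' a d r s i)];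
    rewrite //; exists i.
by case=> [[_ [i ->] ->]|[_ [i ->] ->]]; exists i; [left | right].
Qed.
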